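(* Let $k\ge3$, $d\ge3$, $n:=d-1$, and define $$\alpha_0(k,d):=\min\Big\{\tfrac12e^{-(u_d^\star)^2/2},\ e^{-n},\ \exp\big(-\tfrac{n\log(2k)}2\big),\ \exp\big(-16\,\alpha_d\,(2e)^{(n-1)/2}\big)\Big\}.$$ Then for every $\alpha\in(0,\alpha_0(k,d)]$, the level $u_\alpha>0$ defined, with $\ell:=\log(1/\alpha)$, by $$u_\alpha^2=2\ell+n\log(2k)+2n\log\ell$$ satisfies $\delta_{\min}(u_\alpha)\le\alpha$, where $\delta_{\min}(u):=2\,\delta_{\mathrm{IMF}}(u)$.
   Context: $\rho:=\sqrt{k/(2(k-1))}$, $\Lambda:=2\rho^2-1=1/(k-1)$; $H_j$ physicists' Hermite polynomials; $c_j:=(2^jj!\sqrt\pi)^{-1/2}$; $\mu_m:=\int_{\mathbb R}H_m(y)e^{-y^2/2}dy$; $\alpha_d:=\tfrac12\sqrt{d/2}\,c_{d-1}c_d\mu_d$ for $d$ even, $\alpha_d:=1/\mu_{d-1}$ for $d$ odd; $0!!=1$; $$\beta_d:=\sum_{j=0}^{d-1}c_j^2\,2^j\Big(\frac{(2j)!}{j!}\Big)^2+\sqrt{d/2}\,c_{d-1}c_d\,\frac{(2d-2)!}{(d-1)!}\,2^{d-1}\,\widetilde B_d,$$ $$\widetilde B_d:=\max\Big(\frac{(2d)!\,2^{d+1}}{d!},\ \frac{(2d)!}{d!}\int_0^\infty(1+y)^de^{-y^2/2}\,dy\Big).$$ $u_d^\star$ is the smallest $u\ge2\sqrt d$ satisfying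 $2^{d-2}\beta_d\,u^{d-1}e^{-u^2/4}\le\alpha_d(2\rho)^{d-1}$. $$\Phi_d(\rho,u):=\sum_{j=0}^{\lfloor (d-2)/2\rfloor}2\rho(2\Lambda)^j\frac{(d-2)!!}{(d-2j-2)!!}(2\rho u)^{d-2j-2}+\frac{\mathbf 1_{\{d\text{ odd}\}}}{u}(2\Lambda)^{\frac{d-1}{2}}(d-2)!!,$$ $$\Psi_d(\rho,u):=\frac{c_0^2}{(1+\rho^2)u}+\sum_{j=1}^{d-1}c_j^2\frac{(2\rho)^{2j}u^{2j-1}}{1+\rho^2-(2j-1)/u^2},$$ $$\delta_{\mathrm{IMF}}(u):=2(k-1)^{\frac{d-1}{2}}\big(\alpha_d\Phi_d(\rho,u)e^{-u^2/2}+\Psi_d(\rho,u)e^{-(1+\rho^2)u^2/2}\big).$$ In the definition of $\alpha_0$, $e$ is Euler's number. *)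

(* Defs.v *)
From HB Require Import structures.
From mathcomp Require Import all_boot all_order all_algebra.
From mathcomp Require Import all_classical all_reals all_analysis.
Set Implicit Arguments.
Unset Strict Implicit.
Unset Printing Implicit Defensive.
Import Order.TTheory GRing.Theory Num.Theory.
Import numFieldNormedType.Exports.
Local Open Scope classical_set_scope.
Local Open Scope ring_scope.

Fixpoint dfact (n : nat) : nat :=
  if n is m.+2 then (n * dfact m)%N else 1%N.

(* Physicists' normalisation.  The recurrence H_(n+1) = 2 X H_n - H_n' is the
   Rodrigues formula H_n(x) = (-1)^n e^(x^2) (d/dx)^n e^(-x^2), differentiated
   once more. *)
Fixpoint hermite {R : realType} (n : nat) : {poly R} :=
  if n is m.+1 then 2%:P * 'X * hermite m - (hermite m)^`() else 1.

Definition rho {R : realType} (k : nat) : R :=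
  Num.sqrt (k%:R / (2 * (k%:R - 1))).

Definition Lambda {R : realType} (r : R) : R := 2 * r ^+ 2 - 1.

Definition cH {R : realType} (j : nat) : R :=
  (Num.sqrt (2 ^+ j * (j`!)%:R * Num.sqrt pi))^-1.

Definition mu {R : realType} (m : nat) : R :=
  \int[lebesgue_measure]_y ((hermite m).[y] * expR (- (y ^+ 2 / 2))).

Definition alphad {R : realType} (d : nat) : R :=
  if odd d then (mu (d - 1))^-1
  else 2^-1 * Num.sqrt (d%:R / 2) * cH (d - 1) * cH d * mu d.

Definition Btilde {R : realType} (d : nat) : R :=
  Num.max
    (((2 * d)`!)%:R * 2 ^+ d.+1 / (d`!)%:R)
    (((2 * d)`!)%:R / (d`!)%:R *
       \int[lebesgue_measure]_(y in `[0, +oo[)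
          ((1 + y) ^+ d * expR (- (y ^+ 2 / 2)))).

Definition betad {R : realType} (d : nat) : R :=
  \sum_(0 <= j < d) cH j ^+ 2 * 2 ^+ j * (((2 * j)`!)%:R / (j`!)%:R) ^+ 2
  + Num.sqrt (d%:R / 2) * cH (d - 1) * cH d
    * (((2 * d - 2)`!)%:R / ((d - 1)`!)%:R) * 2 ^+ (d - 1) * Btilde d.

Definition ustar_set {R : realType} (k d : nat) : set R :=
  [set u | 2 * Num.sqrt d%:R <= u /\
     2 ^+ (d - 2) * betad d * u ^+ (d - 1) * expR (- (u ^+ 2 / 4))
       <= alphad d * (2 * rho k) ^+ (d - 1)].

Definition ustar {R : realType} (k d : nat) : R := inf (ustar_set k d).

(* On a nonempty set the infimum is attained: [ustar] is the smallest element. *)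
Lemma ustar_least (R : realType) (k d : nat) :
  @ustar_set R k d !=set0 ->
  ustar_set k d (ustar k d : R) /\
  (forall u : R, ustar_set k d u -> ustar k d <= u).
Proof.
move=> S0; set S := @ustar_set R k d.
have Slb : has_lbound S by exists (2 * Num.sqrt d%:R) => u [].
have hS : has_inf S by [].
split; last by move=> u Su; exact: ge_inf.
split; first by apply: lb_le_inf => // u [].
rewrite leNgt; apply/negP => lt_f.
pose f (u : R) :=
  2 ^+ (d - 2) * betad d * u ^+ (d - 1) * expR (- (u ^+ 2 / 4)).
have cf : {for inf S, continuous f}.
  rewrite /f; apply: cvgM.
    by apply: cvgM; [exact: cvg_cst | exact: exprn_continuous].
  apply: (@continuous_comp _ _ _ (fun u : R => - (u ^+ 2 / 4)) expR);
    last exact: continuous_expR.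
  apply: cvgN; apply: cvgM; [exact: exprn_continuous | exact: cvg_cst].
have : \forall u \near inf S, alphad d * (2 * rho k) ^+ (d - 1) < f u.
  exact: (cvgr_gt (f (inf S)) cf _ lt_f).
case/nbhs_ballP => e /= e0 He.
have [u Su ult] := inf_adherent e0 hS.
have : alphad d * (2 * rho k) ^+ (d - 1) < f u.
  apply: He; rewrite /ball /= distrC ger0_norm ?ltrBlDl //.
  by rewrite subr_ge0 ge_inf.
by case: Su => _; rewrite leNgt => /negP.
Qed.

Definition Phi {R : realType} (d : nat) (r u : R) : R :=
  \sum_(0 <= j < ((d - 2)./2).+1)
     2 * r * (2 * Lambda r) ^+ j
       * ((dfact (d - 2))%:R / (dfact (d - 2 * j - 2))%:R)
       * (2 * r * u) ^+ (d - 2 * j - 2)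
  + (odd d)%:R / u * (2 * Lambda r) ^+ ((d - 1)./2) * (dfact (d - 2))%:R.

Definition Psi {R : realType} (d : nat) (r u : R) : R :=
  cH 0 ^+ 2 / ((1 + r ^+ 2) * u)
  + \sum_(1 <= j < d)
      cH j ^+ 2 * ((2 * r) ^+ (2 * j) * u ^+ (2 * j - 1)
        / (1 + r ^+ 2 - (2 * j - 1)%N%:R / u ^+ 2)).

Definition delta_IMF {R : realType} (k d : nat) (u : R) : R :=
  2 * (k%:R - 1) `^ ((d - 1)%:R / 2) *
  (alphad d * Phi d (rho k) u * expR (- (u ^+ 2 / 2))
   + Psi d (rho k) u * expR (- ((1 + rho k ^+ 2) * u ^+ 2 / 2))).

Definition delta_min {R : realType} (k d : nat) (u : R) : R :=
  2 * delta_IMF k d u.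

Definition alpha0 {R : realType} (k d : nat) : R :=
  let n : R := (d - 1)%:R in
  Num.min (2^-1 * expR (- (ustar k d ^+ 2 / 2)))
  (Num.min (expR (- n))
  (Num.min (expR (- (n * ln (2 * k%:R) / 2)))
           (expR (- (16 * alphad d * (2 * expR 1) `^ ((n - 1) / 2)))))).

(* [Num.sqrt] is 0 on nonpositive reals, so [0 < ulevel k d a] says exactly that
   the displayed quantity is positive and equal to [ulevel k d a ^+ 2]. *)
Definition ulevel {R : realType} (k d : nat) (a : R) : R :=
  let n : R := (d - 1)%:R in
  let l := ln (1 / a) in
  Num.sqrt (2 * l + n * ln (2 * k%:R) + 2 * n * ln l).

(* Main.v *)
Require Import Defs.
From mathcomp Require Import all_boot all_order all_algebra.
From mathcomp Require Import all_classical all_reals all_analysis.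
From mathcomp Require Import ring lra zify.
Import Order.TTheory GRing.Theory Num.Theory.
Local Open Scope ring_scope.

(* Write [n = d - 1], [l = ln (1 / alpha)], [r = rho] and [x = u ^+ 2].  The level
   is chosen so that [(k - 1) ^ (n / 2) * exp (- x / 2)] equals
   [alpha / ((2 r l) ^ n)], hence it suffices to show
   [4 alpha_d Phi <= (2 r l) ^ n / 4] and
   [4 Psi exp (- r^2 x / 2) <= 3 (2 r l) ^ n / 4].
   As [l] dominates [n] and [n ln (2 k) / 2], one has
   [5 n <= x <= 4 l sqrt l <= 3 l^2].  Then [Phi] is bounded by its leading term
   [(2 r) ^ n u ^ (n - 1)] times a geometric series, and the first estimate
   follows from [16 alpha_d (2 e) ^ ((n - 1) / 2) <= l].  The terms of [Psi] are
   those of the exponential series at [2 r^2 x >= 5 n], so the last one dominates;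
   the second estimate follows from [exp (- x / 4) <= (5 / 2 sqrt l) ^ (- n)]. *)

(** * Rational bounds for [expR 1], [ln 2] and [ln 6] *)

Lemma expR1_ge (R : realType) : 13 / 5 <= expR 1 :> R.
Proof.
(* Raising [1 + y <= expR y] at [y = 1/16] to the power 16 gives about 2.64; the upper bound on
   [expR 1] uses [y = -1/16] in the same way. *)
have -> : (1 : R) = 16^-1 * 16%:R by rewrite mulVf.
rewrite expRM_natr; apply: (@le_trans _ _ ((17 / 16) ^+ 16)); first lra.
have := expR_ge1Dx (16^-1 : R); move=> h.
by apply: lerXn2r; rewrite ?nnegrE ?expR_ge0//; lra.
Qed.

Lemma expR1_le (R : realType) : expR 1 <= 141 / 50 :> R.
Proof.
have h : 15 / 16 <= expR (- 16^-1 : R).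
  by have := expR_ge1Dx (- 16^-1 : R); lra.
have : (15 / 16) ^+ 16 <= expR (- 16^-1 : R) ^+ 16.
  by apply: lerXn2r; rewrite ?nnegrE ?expR_ge0//; lra.
rewrite -expRM_natr mulNr mulVf// expRN => {}h.
rewrite -[leLHS]invrK invf_ple ?posrE ?invr_gt0 ?expR_gt0//.
by lra.
Qed.

Lemma ln2_ge (R : realType) : 2 / 3 <= ln 2 :> R.
Proof.
(* Tripling turns the claim into [e^2 <= 2^3], and [(141/50)^2 < 8]. *)
suff : (2 : R) <= ln 2 *+ 3 by lra.
rewrite -lnXn// -[leLHS]expRK ler_ln ?posrE ?expR_gt0 ?exprn_gt0//.
rewrite -[X in expR X](mulr1 2) expRM_natl.
apply: (@le_trans _ _ ((141 / 50) ^+ 2)); last by lra.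
by apply: lerXn2r; rewrite ?nnegrE ?expR_ge0 ?expR1_le//; lra.
Qed.

Lemma ln6_ge (R : realType) : 5 / 3 <= ln 6 :> R.
Proof.
suff : (5 : R) <= ln 6 *+ 3 by lra.
rewrite -lnXn// -[leLHS]expRK ler_ln ?posrE ?expR_gt0 ?exprn_gt0//.
rewrite -[X in expR X](mulr1 5) expRM_natl.
apply: (@le_trans _ _ ((141 / 50) ^+ 5)); last by lra.
by apply: lerXn2r; rewrite ?nnegrE ?expR_ge0 ?expR1_le//; lra.
Qed.

(** * Geometric sums, double factorials and the truncated exponential series *)

Lemma sum_geom_le (R : realFieldType) (q : R) (N : nat) :
  0 <= q -> q < 1 -> \sum_(0 <= j < N) q ^+ j <= (1 - q)^-1.
Proof.
move=> q0 q1; rewrite -[leRHS]mul1r ler_pdivlMr ?subr_gt0//.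
rewrite big_mkord mulrC -[1 - q]opprB mulNr -subrX1 opprB.
by rewrite gerBl exprn_ge0.
Qed.

Lemma dfact_gt0 (m : nat) : (0 < dfact m)%N.
Proof.
elim/ltn_ind: m => -[|[|m]] IH //=.
by rewrite muln_gt0 IH.
Qed.

(** Each of the [j] factors split off from [dfact m] is at most [m]. *)
Lemma dfact_leX (m j : nat) :
  (2 * j <= m)%N -> (dfact m <= dfact (m - 2 * j) * m ^ j)%N.
Proof.
elim: j => [|j IH] jm; first by rewrite muln0 subn0 muln1.
apply: leq_trans (IH _) _; first by lia.
have -> : (m - 2 * j = (m - 2 * j.+1).+2)%N by lia.
rewrite [dfact _.+2]/= expnSr mulnA [leqRHS]mulnC mulnA leq_mul2r.
apply/orP; right; rewrite leq_mul2r; apply/orP; right; lia.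
Qed.

(** One power of [m] is given away so that, with [m = d - 2], the exponent agrees with that of
    [2 * Lambda r] in the extra term of [Phi]. *)
Lemma dfact_le_oddX (m : nat) : odd m -> (dfact m <= m ^ (m.+1)./2)%N.
Proof.
move=> om; have em := odd_double_half m; rewrite om in em.
apply: leq_trans (@dfact_leX m m./2 _) _; first by lia.
have -> : (m - 2 * m./2 = 1)%N by lia.
by rewrite mul1n leq_pexp2l//; lia.
Qed.

(** Consecutive terms grow by a factor of at least 5, so read backwards they are dominated by a
    geometric series of ratio 1/5, whose sum is 5/4. *)
Lemma sum_exp_coeff_le (R : realFieldType) (y : R) (n : nat) :
  0 <= y -> 5 * n%:R <= y ->
  \sum_(0 <= j < n.+1) y ^+ j / j`!%:R <= 5 / 4 * (y ^+ n / n`!%:R).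
Proof.
move=> y0; elim: n => [|n IH] yn; first by rewrite big_nat1 expr0 divr1; lra.
have n0 : 0 <= n%:R :> R by [].
rewrite big_nat_recr//=.
have f0 : 0 < n`!%:R :> R by rewrite ltr0n fact_gt0.
set t := y ^+ n / n`!%:R in IH *.
have t0 : 0 <= t by rewrite divr_ge0 ?exprn_ge0// ltW.
have -> : y ^+ n.+1 / (n.+1)`!%:R = t * (y / n.+1%:R).
  by rewrite factS natrM exprSr /t; field; rewrite !gt_eqF//.
have z5 : 5 <= y / n.+1%:R by rewrite ler_pdivlMr.
have /IH : 5 * n%:R <= y by rewrite -(natr1 n) in yn; lra.
move: (y / _) z5 => z z5; have := ler_wpM2l t0 z5.
lra.
Qed.

(** * Bounding [Phi] by its leading term *)

Lemma Phi_ge0 (R : realType) (d : nat) (r u : R) :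
  0 < r -> 0 < u -> 0 <= Lambda r -> 0 <= Phi d r u.
Proof.
move=> r0 u0 L0.
have aj j : 0 <= (2 * Lambda r) ^+ j by rewrite exprn_ge0// mulr_ge0.
have r2 : 0 <= 2 * r by rewrite mulr_ge0// ltW.
apply: addr_ge0; last by rewrite !mulr_ge0// invr_ge0 ltW.
by apply: sumr_ge0 => j _; rewrite !mulr_ge0 ?invr_ge0 ?exprn_ge0 ?mulr_ge0// ltW.
Qed.

(* With [w := 2 r u], each term of [Phi], the extra one for odd [d] included, is
   at most [2 r w ^+ (d - 2)] times a power of [q]. *)
Lemma Phi_le (R : realType) (d : nat) (r u q : R) :
  (2 <= d)%N -> 0 < r -> 0 < u -> 0 <= Lambda r -> 0 <= q -> q < 1 ->
  2 * Lambda r * (d - 2)%:R <= q * (2 * r * u) ^+ 2 ->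
  Phi d r u <= (2 * r) ^+ (d - 1) * u ^+ (d - 2) / (1 - q).
Proof.
case: d => [|[|m]]// _ r0 u0 L0 q0 q1; rewrite /Phi !subSS !subn0 /= negbK.
set a := 2 * Lambda r; set w := 2 * r * u => aw.
have a0 : 0 <= a by rewrite mulr_ge0.
have w0 : 0 < w by rewrite !mulr_gt0.
have rw : 0 < 2 * r * w ^+ m by rewrite !mulr_gt0// exprn_gt0.
have step j : (a * m%:R) ^+ j <= q ^+ j * w ^+ (2 * j).
  by rewrite exprM -exprMn lerXn2r ?nnegrE ?mulr_ge0 ?exprn_ge0// ltW.
have term j : (2 * j <= m)%N -> 2 * r * a ^+ j
    * ((dfact m)%:R / (dfact (m.+2 - 2 * j - 2))%:R)
    * w ^+ (m.+2 - 2 * j - 2) <= 2 * r * w ^+ m * q ^+ j.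
  move=> jm; have -> : (m.+2 - 2 * j - 2 = m - 2 * j)%N by lia.
  have wj : w ^+ m = w ^+ (2 * j) * w ^+ (m - 2 * j).
    by rewrite -exprD subnKC.
  have h : (dfact m)%:R / (dfact (m - 2 * j))%:R <= m%:R ^+ j :> R.
    rewrite ler_pdivrMr ?ltr0n ?dfact_gt0// -natrX -natrM ler_nat mulnC.
    exact: dfact_leX.
  rewrite wj -!mulrA ler_pM2l// ler_pM2l// !mulrA.
  rewrite [leRHS]mulrAC ler_pM2r ?exprn_gt0//.
  apply: (@le_trans _ _ (a ^+ j * m%:R ^+ j)).
    by rewrite -mulrA ler_wpM2l// exprn_ge0.
  by rewrite -exprMn [leRHS]mulrC.
have oddterm : odd m -> 1%:R / u * a ^+ m.+1./2 * (dfact m)%:R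
    <= 2 * r * w ^+ m * q ^+ m.+1./2.
  move=> om; have em : (2 * m.+1./2 = m.+1)%N.
    by rewrite mul2n even_halfK //= om.
  (* This trades the factor [1 / u] for one more power of [w]; since [m + 1] is even, [step] then
     applies with exponent [(m + 1) / 2], the next one after those of the sum. *)
  have wE : 2 * r * w ^+ m = w ^+ m.+1 / u.
    by rewrite exprS {2}/w; field; rewrite gt_eqF.
  rewrite wE [leRHS]mulrAC mul1r -mulrA [leRHS]mulrC ler_pM2l ?invr_gt0//.
  apply: (@le_trans _ _ (a ^+ m.+1./2 * m%:R ^+ m.+1./2)).
    by rewrite ler_wpM2l ?exprn_ge0// -natrX ler_nat dfact_le_oddX.
  by rewrite -exprMn; apply: le_trans (step _) _; rewrite em mulrC.
have -> : (2 * r) ^+ m.+1 * u ^+ m / (1 - q) = 2 * r * w ^+ m * (1 - q)^-1.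
  by rewrite [w ^+ m]exprMn exprS !mulrA.
have hsum : \sum_(0 <= j < (m./2).+1) 2 * r * a ^+ j
    * ((dfact m)%:R / (dfact (m.+2 - 2 * j - 2))%:R)
    * w ^+ (m.+2 - 2 * j - 2)
    <= 2 * r * w ^+ m * \sum_(0 <= j < (m./2).+1) q ^+ j.
  rewrite mulr_sumr; apply: ler_sum_nat => j /andP[_ jm]; apply: term.
  rewrite -(odd_double_half m) mul2n; apply: leq_trans (leq_addl _ _).
  by rewrite leq_double.
apply: (@le_trans _ _
  (2 * r * w ^+ m * \sum_(0 <= j < ((m./2).+1 + odd m)%N) q ^+ j)); last first.
  by rewrite ler_pM2l// sum_geom_le.
have [om|om] := boolP (odd m); last first.
  by rewrite addn0 !mul0r addr0.
rewrite addn1 [X in _ <= _ * X]big_nat_recr//= mulrDr lerD//.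
have -> : ((m./2).+1 = m.+1./2)%N.
  by rewrite /= uphalf_half om.
exact: oddterm.
Qed.

(** * Comparing [Psi] with the exponential series *)

Lemma cH_sqr (R : realType) (j : nat) :
  cH j ^+ 2 = (2 ^+ j * j`!%:R * Num.sqrt pi)^-1 :> R.
Proof.
by rewrite /cH exprVn sqr_sqrtr// !mulr_ge0 ?sqrtr_ge0// exprn_ge0.
Qed.

Lemma Psi_le (R : realType) (d : nat) (r u : R) :
  (0 < d)%N -> 0 < u -> 1 / 2 <= r ^+ 2 -> 4 * (d - 1)%:R <= u ^+ 2 -> 0 <= r ->
  Psi d r u <= (Num.sqrt pi * u)^-1
    * \sum_(0 <= j < d) (2 * r ^+ 2 * u ^+ 2) ^+ j / j`!%:R.
Proof.
move=> d0 u0 r2 hd r0.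
have sp : 0 < Num.sqrt pi :> R by rewrite sqrtr_gt0 pi_gt0.
rewrite big_ltn// mulrDr /Psi lerD//.
  have -> : cH 0 ^+ 2 = (Num.sqrt pi)^-1 :> R.
    by rewrite cH_sqr expr0 fact0 !mul1r.
  rewrite expr0 fact0 divr1 mulr1 -invfM lef_pV2 ?posrE ?mulr_gt0//; last by lra.
  by rewrite ler_pM2l// ler_peMl ?ltW//; lra.
rewrite mulr_sumr; apply: ler_sum_nat => j /andP[j0 jd].
set D := 1 + _ - _.
have D1 : 1 <= D.
  have : (2 * j - 1)%:R / u ^+ 2 <= 1 / 2.
    rewrite ler_pdivrMr ?exprn_gt0//.
    have : (2 * (2 * j - 1))%:R <= (4 * (d - 1))%:R :> R by rewrite ler_nat; lia.
    by rewrite !natrM; lra.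
  by rewrite /D; lra.
have u21 : u ^+ (2 * j - 1) = u ^+ (2 * j) / u.
  have e : (2 * j = (2 * j - 1).+1)%N by lia.
  by rewrite [X in u ^+ X / _]e exprSr mulfK ?gt_eqF.
have f0 : 0 < j`!%:R :> R by rewrite ltr0n fact_gt0.
set A := (2 ^+ j * j`!%:R * Num.sqrt pi)^-1 * ((2 * r) ^+ (2 * j) * u ^+ (2 * j - 1)).
have <- : A = (Num.sqrt pi * u)^-1 * ((2 * r ^+ 2 * u ^+ 2) ^+ j / j`!%:R).
  rewrite /A u21 !exprM !exprMn.
  by field; rewrite ?gt_eqF// exprn_gt0.
rewrite cH_sqr mulrA -/A ler_piMr ?invf_le1 ?(lt_le_trans ltr01 D1)//.
by rewrite mulr_ge0 ?invr_ge0 ?mulr_ge0 ?exprn_ge0 ?mulr_ge0// ltW.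
Qed.

(** * Size of the squared level, with [L] standing for [ln (2k)] *)

Lemma ln_sqrt2 (R : realType) (l : R) : 0 < l -> ln l = 2 * ln (Num.sqrt l).
Proof.
move=> l0; rewrite -{1}(sqr_sqrtr (ltW l0)) lnXn ?sqrtr_gt0//.
by rewrite mulr_natl.
Qed.

(** The lower bound adds [2n], [5n/3] and [4n/3]. For the upper ones, [n L <= 2l] and
    [ln l <= 2 (sqrt l - 1)] make the terms linear in [l] cancel, and [4 <= 3 sqrt l] because
    [l >= 2]. *)
Lemma sqr_level_bounds (R : realType) (n : nat) (l L : R) :
  (2 <= n)%N -> 5 / 3 <= L -> n%:R <= l -> n%:R * L / 2 <= l ->
  let x := 2 * l + n%:R * L + 2 * n%:R * ln l in
  [/\ 5 * n%:R <= x, x <= 4 * l * Num.sqrt l & x <= 3 * l ^+ 2].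
Proof.
move=> n2 L53 nl nLl x.
have n2R : 2 <= n%:R :> R by rewrite ler_nat.
have l2 : 2 <= l by lra.
have l0 : 0 < l by lra.
have lnl : 2 / 3 <= ln l.
  by apply: le_trans (ln2_ge R) _; rewrite ler_ln ?posrE.
have s0 : 0 < Num.sqrt l by rewrite sqrtr_gt0.
have lns : ln (Num.sqrt l) <= Num.sqrt l - 1.
  have := expR_ge1Dx (ln (Num.sqrt l)); rewrite lnK ?posrE//; lra.
have xs : x <= 4 * l * Num.sqrt l.
  have h : n%:R * ln l <= l * ln l by rewrite ler_wpM2r//; lra.
  have : l * ln l <= l * (2 * (Num.sqrt l - 1)).
    by rewrite ler_wpM2l ?(ltW l0)// ln_sqrt2//; lra.
  by rewrite /x; lra.
split => //.
  have h1 : n%:R * (5 / 3) <= n%:R * L by rewrite ler_wpM2l.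
  have h2 : n%:R * (2 / 3) <= n%:R * ln l by rewrite ler_wpM2l.
  by rewrite /x; lra.
apply: le_trans xs _; have := sqr_sqrtr (ltW l0).
set s := Num.sqrt l in s0 * => sE.
by rewrite -sE in l2 *; nra.
Qed.

(** Using [l >= n], the exponent is at least [n (1/2 + ln 6 / 4 + ln (sqrt l))]; the constant 5/2
    comes from [(5/2)^4 <= 6 e^2]. *)
Lemma expR_sqr_level_ge (R : realType) (n : nat) (l L : R) :
  0 < l -> n%:R <= l -> ln 6 <= L ->
  (5 / 2 * Num.sqrt l) ^+ n
    <= expR ((2 * l + n%:R * L + 2 * n%:R * ln l) / 4).
Proof.
move=> l0 nl L6; have n0 : 0 <= n%:R :> R by [].
apply: (@le_trans _ _ (expR (n%:R * (2^-1 + ln 6 / 4 + ln (Num.sqrt l))))).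
  rewrite expRM_natl lerXn2r ?nnegrE ?expR_ge0 ?mulr_ge0 ?sqrtr_ge0//.
  rewrite expRD lnK ?posrE ?sqrtr_gt0// ler_wpM2r ?sqrtr_ge0//.
  rewrite -(@ler_pXn2r _ 4) ?nnegrE ?expR_ge0// -expRM_natl.
  have -> : 4 * (2^-1 + ln 6 / 4) = 1 * 2%:R + ln 6 :> R by lra.
  rewrite expRD expRM_natr lnK ?posrE//.
  have : (13 / 5) ^+ 2 <= expR 1 ^+ 2 :> R.
    by rewrite lerXn2r ?nnegrE ?expR_ge0 ?expR1_ge.
  lra.
rewrite ler_expR.
have h1 : n%:R * ln 6 <= n%:R * L by rewrite ler_wpM2l.
by rewrite [ln l]ln_sqrt2//; lra.
Qed.

(** * The estimate for [Psi] *)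

Lemma expr_fact_le (R : realType) (b : R) (n : nat) :
  0 <= b -> b ^+ 2 <= 32 / 25 -> (2 <= n)%N -> b ^+ n / n`!%:R <= 16 / 25.
Proof.
move=> b0 b2; elim: n => // n IH; rewrite leq_eqVlt => /orP[/eqP[<-]|n2].
  by rewrite (_ : 2`! = 2%N)//; lra.
(* From [n = 2] on, each step multiplies by [b / (n + 1) <= 1]. *)
have b3 : b <= 3 by nra.
have nb : b <= n.+1%:R by apply: le_trans b3 _; rewrite ler_nat.
apply: le_trans (IH n2); rewrite factS natrM exprSr invfM [X in _ * X <= _]mulrC mulrACA.
rewrite ler_piMr ?mulr_ge0 ?invr_ge0 ?exprn_ge0//.
by rewrite ler_pdivrMr// mul1r.
Qed.

(* Since [2 r^2 <= exp (2 r^2 - 1)], the left-hand side is largest at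
   [r^2 = 1/2]. *)
Lemma gauss_factor_le (R : realType) (r x : R) (n : nat) :
  0 <= r -> 1 / 2 <= r ^+ 2 -> 2 * n%:R <= x ->
  (Num.sqrt 2 * r) ^+ n * expR (- (r ^+ 2 * x / 2)) <= expR (- (x / 4)).
Proof.
move=> r0 r2 nx.
have -> : - (r ^+ 2 * x / 2) = - (x / 4) - (2 * r ^+ 2 - 1) * x / 4 by lra.
rewrite expRD mulrCA ler_piMr ?expR_ge0// expRN -ler_pdivlMr ?invr_gt0 ?expR_gt0//.
rewrite invrK mul1r.
apply: (@le_trans _ _ (expR (n%:R * ((2 * r ^+ 2 - 1) / 2)))).
  rewrite expRM_natl lerXn2r ?nnegrE ?expR_ge0 ?mulr_ge0 ?sqrtr_ge0//.
  rewrite -(@ler_pXn2r _ 2) ?nnegrE ?expR_ge0 ?mulr_ge0 ?sqrtr_ge0//.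
  rewrite -expRM_natl exprMn sqr_sqrtr//.
  have -> : 2 * ((2 * r ^+ 2 - 1) / 2) = 2 * r ^+ 2 - 1 by lra.
  by have := expR_ge1Dx (2 * r ^+ 2 - 1); lra.
rewrite ler_expR; have : 0 <= (x - 2 * n%:R) * (2 * r ^+ 2 - 1).
  by rewrite mulr_ge0//; lra.
lra.
Qed.

Lemma Psi_exp_le (R : realType) (r u l : R) (n : nat) :
  (2 <= n)%N -> 0 < r -> 0 < u -> 0 < l -> 1 / 2 <= r ^+ 2 ->
  5 * n%:R <= u ^+ 2 -> u ^+ 2 <= 4 * l * Num.sqrt l ->
  (5 / 2 * Num.sqrt l) ^+ n <= expR (u ^+ 2 / 4) ->
  4 * (Psi n.+1 r u * expR (- (r ^+ 2 * u ^+ 2 / 2)))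
    <= 3 / 4 * ((2 * r) ^+ n * l ^+ n).
Proof.
move=> n2 r0 u0 l0 r2 ux xl xe.
have n2R : 2 <= n%:R :> R by rewrite ler_nat.
set x := u ^+ 2 in ux xl xe *.
set e := expR _.
have e0 : 0 < e by exact: expR_gt0.
(* Here [pi * u^2 >= 2 * 10], while [(64/15)^2 < 19]. *)
have pu : 64 / 15 <= Num.sqrt pi * u.
  rewrite -(@ler_pXn2r _ 2) ?nnegrE ?mulr_ge0 ?sqrtr_ge0 ?(ltW u0)//.
  rewrite [leRHS]exprMn sqr_sqrtr ?pi_ge0// -/x.
  have p2 := pi_ge2 R; have x10 : 10 <= x by lra.
  by have := ler_pM (ler0n R 2) (ler0n R 10) p2 x10; lra.
have pu0 : 0 < Num.sqrt pi * u by lra.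
have f0 : 0 < n`!%:R :> R by rewrite ltr0n fact_gt0.
have s0 : 0 < Num.sqrt l by rewrite sqrtr_gt0.
have x0 : 0 < x by rewrite exprn_gt0.
have w0 : 0 < Num.sqrt 2 :> R by rewrite sqrtr_gt0.
have ww : Num.sqrt 2 ^+ 2 = 2 :> R by rewrite sqr_sqrtr.
have y0 : 0 <= 2 * r ^+ 2 * x by rewrite !mulr_ge0 ?exprn_ge0 ?ltW.
have yn : 5 * n%:R <= 2 * r ^+ 2 * x.
  by apply: le_trans ux _; rewrite ler_peMl ?(ltW x0)//; lra.
have hPsi : Psi n.+1 r u <= (Num.sqrt pi * u)^-1
    * (5 / 4 * ((2 * r ^+ 2 * x) ^+ n / n`!%:R)).
  apply: le_trans (@Psi_le R n.+1 r u _ _ _ _ _) _ => //.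
  - by rewrite subn1 /= -/x; lra.
  - exact: ltW.
  - by rewrite ler_wpM2l ?invr_ge0 ?(ltW pu0)// sum_exp_coeff_le.
have hg : (Num.sqrt 2 * r) ^+ n * e * (5 / 2 * Num.sqrt l) ^+ n <= 1.
  apply: (@le_trans _ _ (expR (- (x / 4)) * expR (x / 4))).
    have g := gauss_factor_le R r x n (ltW r0) r2 ltac:(lra).
    by apply: ler_pM g xe; rewrite ?mulr_ge0 ?exprn_ge0 ?mulr_ge0 // ltW.
  by rewrite -expRD addNr expR0.
(* This [b] makes [8 r^2 l sqrt l] split as [(2r) (b l)] times [(sqrt 2 r) (5/2 sqrt l)]; the [n]-th
   power of the second product is absorbed by [e] through [hg], and [b^2 = 32/25]. *)
set b : R := 8 / 5 / Num.sqrt 2.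
have b0 : 0 < b by rewrite divr_gt0.
have bf : b ^+ n / n`!%:R <= 16 / 25.
  apply: expr_fact_le => //; first exact: ltW.
  by rewrite /b expr_div_n ww; lra.
have hx : (2 * r ^+ 2 * x) ^+ n * e <= (2 * r) ^+ n * (b * l) ^+ n.
  have r20 : 0 <= 2 * r ^+ 2 by lra.
  apply: (@le_trans _ _ ((2 * r ^+ 2 * (4 * l * Num.sqrt l)) ^+ n * e)).
    have xx : 2 * r ^+ 2 * x <= 2 * r ^+ 2 * (4 * l * Num.sqrt l).
      by rewrite ler_wpM2l.
    by rewrite ler_pM2r// lerXn2r// nnegrE (le_trans y0 xx).
  have -> : 2 * r ^+ 2 * (4 * l * Num.sqrt l)
      = (2 * r) * (b * l) * ((Num.sqrt 2 * r) * (5 / 2 * Num.sqrt l)).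
    by rewrite /b; field; rewrite gt_eqF.
  rewrite 2!(exprMn n _ (_ * _)) -[leLHS]mulrA.
  rewrite ler_piMr ?mulr_ge0 ?exprn_ge0 ?mulr_ge0 ?(ltW r0) ?(ltW b0) ?(ltW l0)//.
  by rewrite exprMn mulrAC.
have hz : (2 * r ^+ 2 * x) ^+ n / n`!%:R * e <= 16 / 25 * ((2 * r) ^+ n * l ^+ n).
  rewrite mulrAC ler_pdivrMr//; apply: le_trans hx _.
  rewrite (exprMn n b l) mulrCA [leRHS]mulrAC ler_wpM2r//.
    by rewrite mulr_ge0 ?exprn_ge0 ?mulr_ge0 ?(ltW r0) ?(ltW l0).
  by rewrite -ler_pdivrMr.
have hp : (Num.sqrt pi * u)^-1 <= 15 / 64.
  by rewrite invf_ple ?posrE// invf_div.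
have z0 : 0 <= (2 * r ^+ 2 * x) ^+ n / n`!%:R * e.
  by rewrite mulr_ge0 ?divr_ge0 ?exprn_ge0 ?(ltW e0).
have p0 : 0 <= (Num.sqrt pi * u)^-1 by rewrite invr_ge0 ltW.
(* The constants multiply to [4 * 15/64 * 5/4 * 16/25 = 3/4]. *)
have := ler_wpM2r (ltW e0) hPsi; have := ler_pM p0 z0 hp hz.
lra.
Qed.

(** * The estimate for [alphad d * Phi] *)

Lemma powR_half_natr (R : realType) (a : R) (n : nat) :
  0 <= a -> a `^ (n%:R / 2) = Num.sqrt a ^+ n.
Proof.
by move=> a0; rewrite mulrC powRrM powR12_sqrt// powR_mulrn// sqrtr_ge0.
Qed.

Lemma mul_Phi_le (R : realType) (d : nat) (a r u l : R) :
  (3 <= d)%N -> 0 < r -> 0 < u -> 0 < l -> 0 <= Lambda r ->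
  2 * Lambda r * (d - 2)%:R <= 1 / 12 * (2 * r * u) ^+ 2 ->
  u ^+ 2 <= 3 * l ^+ 2 ->
  16 * a * (2 * expR 1) `^ (((d - 1)%:R - 1) / 2) <= l ->
  4 * (a * Phi d r u) <= 1 / 4 * ((2 * r) ^+ (d - 1) * l ^+ (d - 1)).
Proof.
move=> d3 r0 u0 l0 L0 hq ul.
have d1 : (d - 1 = (d - 2).+1)%N by lia.
have d2 : (0 < d - 2)%N by lia.
have c0 : 0 <= 9 / 10 :> R by lra.
have c1 : 9 / 10 <= 1 :> R by lra.
have -> : (d - 1)%:R - 1 = (d - 2)%:R :> R.
  by rewrite d1 -natr1 addrK.
have e1 := expR1_ge R.
rewrite powR_half_natr ?mulr_ge0 ?expR_ge0//.
set t := Num.sqrt _; set T := t ^+ _ => hl.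
have r2 : 0 < 2 * r by rewrite mulr_gt0.
have RHS0 : 0 <= 1 / 4 * ((2 * r) ^+ (d - 1) * l ^+ (d - 1)).
  by rewrite !mulr_ge0// exprn_ge0// ltW.
(* Splitting on the sign of [a] avoids having to determine the sign of the integral in [alphad]. *)
have [a0|a0] := leP a 0.
  apply: le_trans RHS0; rewrite pmulr_rle0//.
  by rewrite mulr_le0_ge0// Phi_ge0.
have t0 : 0 <= t by rewrite sqrtr_ge0.
have tE : t ^+ 2 = 2 * expR 1 by rewrite sqr_sqrtr// mulr_ge0 ?expR_ge0.
have tl0 : 0 <= t * l by rewrite mulr_ge0// ltW.
(* There is room because [3 < (9/10)^2 * 2e]. As [d - 2 >= 1], a factor 9/10 survives in [hu] and
   pays for the 12/11 of the geometric series. *)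
have utl : u <= 9 / 10 * (t * l).
  rewrite -(@ler_pXn2r _ 2) ?nnegrE ?(ltW u0) ?mulr_ge0 ?(ltW l0)//.
  rewrite [leRHS]exprMn [(t * l) ^+ 2]exprMn tE; apply: le_trans ul _.
  by rewrite [leRHS]mulrA ler_pM2r ?exprn_gt0//; lra.
have hu : u ^+ (d - 2) <= 9 / 10 * (T * l ^+ (d - 2)).
  apply: (@le_trans _ _ ((9 / 10 * (t * l)) ^+ (d - 2))).
    by rewrite lerXn2r// nnegrE ?(ltW u0)// (le_trans (ltW u0)).
  rewrite [leLHS]exprMn [(t * l) ^+ _]exprMn ler_wpM2r ?mulr_ge0 ?exprn_ge0 ?(ltW l0)//.
  exact: ler_iXnr.
have hPhi := @Phi_le R d r u (1 / 12) (ltnW d3) r0 u0 L0 ltac:(lra) ltac:(lra) hq.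
have ld : l ^+ (d - 1) = l * l ^+ (d - 2).
  by rewrite d1 exprS.
have W0 : 0 < (2 * r) ^+ (d - 1) * l ^+ (d - 2) by rewrite mulr_gt0 ?exprn_gt0.
have h1 := ler_wpM2l (ltW W0) hl.
have h2 : a * (2 * r) ^+ (d - 1) * u ^+ (d - 2)
    <= a * (2 * r) ^+ (d - 1) * (9 / 10 * (T * l ^+ (d - 2))).
  by rewrite ler_wpM2l// mulr_ge0 ?exprn_ge0 ?(ltW a0)// ltW.
have h3 := ler_wpM2l (ltW a0) hPhi.
rewrite (_ : (1 - 1 / 12)^-1 = 12 / 11 :> R) in h3; last by field.
have l1 : 0 <= (2 * r) ^+ (d - 1) * l ^+ (d - 2) * l.
  by rewrite mulr_ge0 ?ltW.
rewrite ld; lra.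
Qed.

(** * The Gaussian factor at the level, and the conclusion *)

Lemma rho_sqr (R : realType) (k : nat) :
  (2 <= k)%N -> rho k ^+ 2 = k%:R / (2 * (k%:R - 1)) :> R.
Proof.
move=> k2; rewrite sqr_sqrtr// divr_ge0// mulr_ge0// subr_ge0.
by rewrite ler1n ltnW.
Qed.

(** The three terms of the level contribute [alpha], [(2k)^(-n/2)] and [l^(-n)]; since
    [sqrt (2k) = 2 rho sqrt (k - 1)], the power of [k - 1] cancels. *)
Lemma powR_mul_gauss_level (R : realType) (k n : nat) (alpha : R) :
  (3 <= k)%N -> 0 < alpha -> 0 < ln (1 / alpha) ->
  let l := ln (1 / alpha) in
  (k%:R - 1) `^ (n%:R / 2)
    * expR (- ((2 * l + n%:R * ln (2 * k%:R) + 2 * n%:R * ln l) / 2))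
  = alpha / ((2 * rho k) ^+ n * l ^+ n).
Proof.
move=> k3 a0 l0 l.
have k3R : 3 <= k%:R :> R by rewrite ler_nat.
rewrite powR_half_natr; last by lra.
set K := Num.sqrt _; have K0 : 0 < K by rewrite sqrtr_gt0; lra.
have r0 : 0 < rho k :> R by rewrite sqrtr_gt0 divr_gt0//; lra.
set G := Num.sqrt (2 * k%:R : R).
have G0 : 0 < G by rewrite sqrtr_gt0; lra.
have GE : G = 2 * rho k * K.
  apply/eqP; rewrite -(@eqrXn2 _ 2)// ?(ltW G0)//; last by rewrite !mulr_ge0// ltW.
  rewrite [X in _ == X]exprMn [X in _ == X * _]exprMn rho_sqr ?(ltnW k3)//.
  rewrite !sqr_sqrtr; [|lra|lra].
  by apply/eqP; field; rewrite gt_eqF//; lra.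
have -> : - ((2 * l + n%:R * ln (2 * k%:R) + 2 * n%:R * ln l) / 2)
    = - l + n%:R * - ln G + n%:R * - ln l.
  by rewrite (@ln_sqrt2 _ (2 * k%:R)) -/G; [field | lra].
have el : expR (- l) = alpha by rewrite /l div1r lnV ?posrE// opprK lnK.
rewrite !expRD !expRM_natl el !expRN !lnK ?posrE// GE !exprVn.
rewrite [(2 * rho k * K) ^+ n]exprMn.
by field; rewrite !gt_eqF// exprn_gt0// mulr_gt0.
Qed.

Theorem proposition10 (R : realType) (k d : nat) (hk : (3 <= k)%N)
    (hd : (3 <= d)%N) (alpha : R) (alpha_gt0 : 0 < alpha)
    (alpha_le : alpha <= alpha0 k d) :
  0 < ulevel k d alpha /\ delta_min k d (ulevel k d alpha) <= alpha.
Proof.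
have k3 : 3 <= k%:R :> R by rewrite ler_nat.
have dE : (d = (d - 1).+1)%N by lia.
have n2 : (2 <= d - 1)%N by lia.
have n2R : 2 <= (d - 1)%:R :> R by rewrite ler_nat.
have le_l z : alpha <= expR (- z) -> z <= ln (1 / alpha).
  move=> h; rewrite div1r lnV ?posrE// lerNr.
  by rewrite -[leRHS]expRK ler_ln ?posrE ?expR_gt0.
move: alpha_le; rewrite /alpha0 !le_min => /and4P[_ /le_l nl /le_l nLl /le_l al].
rewrite /ulevel; set l := ln (1 / alpha) in nl nLl al *.
have l0 : 0 < l by lra.
have L6 : ln 6 <= ln (2 * k%:R) :> R by rewrite ler_ln ?posrE; lra.
have L53 : 5 / 3 <= ln (2 * k%:R) :> R := le_trans (ln6_ge R) L6.
have [] := @sqr_level_bounds R _ _ _ n2 L53 nl nLl.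
have := @expR_sqr_level_ge R _ _ _ l0 nl L6.
have := @powR_mul_gauss_level R k (d - 1) _ hk alpha_gt0 l0.
rewrite /= -/l.
set x := 2 * l + _ + _ => pE xe xn xs xl; clearbody x l.
have x0 : 0 < x by lra.
have u0 : 0 < Num.sqrt x by rewrite sqrtr_gt0.
split=> //; set u := Num.sqrt x in u0 *.
have ux : u ^+ 2 = x by rewrite sqr_sqrtr// ltW.
set r : R := rho k in pE *.
have rE : r ^+ 2 = k%:R / (2 * (k%:R - 1)) by rewrite rho_sqr// ltnW.
have r0 : 0 < r by rewrite sqrtr_gt0 divr_gt0//; lra.
have r12 : 1 / 2 <= r ^+ 2.
  by rewrite rE ler_pdivlMr; lra.
have r34 : r ^+ 2 <= 3 / 4.
  by rewrite rE ler_pdivrMr; lra.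
have P0 : 0 < (2 * r) ^+ (d - 1) * l ^+ (d - 1).
  by rewrite mulr_gt0 ?exprn_gt0// mulr_gt0.
have hA : 4 * (alphad d * Phi d r u)
    <= 1 / 4 * ((2 * r) ^+ (d - 1) * l ^+ (d - 1)).
  apply: mul_Phi_le => //; [by rewrite /Lambda; lra| |by rewrite ux].
  rewrite exprMn ux [(2 * r) ^+ 2]exprMn /Lambda.
  have m0 : 0 <= (d - 2)%:R :> R by [].
  have mx : 5 * (d - 2)%:R <= x.
    by apply: le_trans xn; rewrite ler_wpM2l// ler_nat leq_sub2l.
  (* Equivalent to [r^2 <= 3/4] when [d > 2], which is where [k >= 3] enters. With [5 (d - 2) <= x]
     the ratio is at most 1/15, below the 1/12 required. *)
  have : (2 * r ^+ 2 - 1) * (d - 2)%:R <= r ^+ 2 * (2 / 3) * (d - 2)%:R.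
    by rewrite ler_wpM2r//; lra.
  have := ler_wpM2l (sqr_ge0 r) mx.
  have := ler_wpM2l (sqr_ge0 r) m0.
  lra.
have hB : 4 * (Psi d r u * expR (- (r ^+ 2 * x / 2)))
    <= 3 / 4 * ((2 * r) ^+ (d - 1) * l ^+ (d - 1)).
  by rewrite {1}dE -ux; apply: Psi_exp_le => //; rewrite ?ux.
rewrite /delta_min /delta_IMF -/r ux.
have -> : - ((1 + r ^+ 2) * x / 2) = - (x / 2) + - (r ^+ 2 * x / 2) by lra.
rewrite expRD.
set P := _ * l ^+ _ in pE P0 hA hB.
set E := expR (- (x / 2)) in pE *; set E2 := expR _ in hB *.
(* The common factor becomes [alpha / P], and [hA] and [hB] bound the rest by [P/4 + 3P/4]. *)
have -> : 2 * (2 * (k%:R - 1) `^ ((d - 1)%:R / 2)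
    * (alphad d * Phi d r u * E + Psi d r u * (E * E2)))
  = (k%:R - 1) `^ ((d - 1)%:R / 2) * E
    * (4 * (alphad d * Phi d r u) + 4 * (Psi d r u * E2)) by ring.
rewrite pE mulrAC ler_pdivrMr// ler_pM2l//; lra.
Qed.
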